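(* Let $\mathcal A$ be a pointed regular category. The following conditions are equivalent: \begin{enumerate} \item $\mathcal A$ is protomodular (and then homological). \item For every fibration $(f,f_0)\colon a\to b$ in $\mathbf{Arr}(\mathcal A)$, the canonical comparison $J\colon\mathbb K\mathrm{er}(f,f_0)\to\mathbb K(f,f_0)$ from the kernel to the strong h-kernel of $(f,f_0)$ is a weak equivalence in $\mathbf{Arr}(\mathcal A)$. \end{enumerate}
   Context: Composition is written diagrammatically: $f\cdot g$ means first $f$, then $g$. Pointed means having a zero object $0$. A category is homological if it is pointed, regular and protomodular. For an arrow $f$, $k_f\colon\mathrm{Ker}(f)\to\cdot$ denotes its kernel. **The category $\mathbf{Arr}(\mathcal A)$.** Objects are arrows $a\colon A\to A_0$ of $\mathcal A$; morphisms $(f,f_0)\colon a\to b$, where $b\colon B\to B_0$, are pairs $f\colon A\to B$, $f_0\colon A_0\to B_0$ with $f\cdot b=a\cdot f_0$. Let $\partial(f,f_0)_0\colon A\to A_0\times_{f_0,b}B$ be the arrow into the pullback of $f_0$ and $b$ with components $a$ and $f$. The morphism $(f,f_0)$ is: - a fibration if $f$ is a regular epimorphism; - fully faithful if $\partial(f,f_0)_0$ is an isomorphism (i.e. the square is a pullback); - essentially surjective if $f_0$ and $b$ are jointly strongly epimorphic (every monomorphism into $B_0$ through which both factor is an isomorphism); - a weak equivalence if it is fully faithful and essentially surjective. The kernel $\mathbb K\mathrm{er}(f,f_0)$ is the level-wise kernel, i.e. the arrow $\mathrm K(a)\colon\mathrm{Ker}(f)\to\mathrm{Ker}(f_0)$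 induced by $a$. The strong h-kernel $\mathbb K(f,f_0)$ is the object $\partial(f,f_0)_0\colon A\to A_0\times_{f_0,b}B$ of $\mathbf{Arr}(\mathcal A)$, together with the morphism $(\mathrm{id}_A,b')\colon\partial(f,f_0)_0\to a$ and the null-homotopy $f_0'$, where $b'\colon A_0\times_{f_0,b}B\to A_0$ and $f_0'\colon A_0\times_{f_0,b}B\to B$ are the pullback projections. The canonical comparison $J$ is the morphism $(k_f,\langle k_{f_0},0\rangle)$ from $\mathrm K(a)$ to $\partial(f,f_0)_0$, where $\langle k_{f_0},0\rangle\colon\mathrm{Ker}(f_0)\to A_0\times_{f_0,b}B$. *)

(* Defs.v *)
From Stdlib Require Import ProofIrrelevance.

Set Implicit Arguments.
Unset Strict Implicit.
Unset Printing Implicit Defensive.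

Declare Scope cat_scope.
Delimit Scope cat_scope with cat.
Local Open Scope cat_scope.

(** Composition is diagrammatic: [f ;; g] is first [f], then [g]. *)
Reserved Notation "f ;; g" (at level 40, left associativity).

Record category := Category {
  ob :> Type;
  hom : ob -> ob -> Type;
  idm : forall X, hom X X;
  comp : forall X Y Z, hom X Y -> hom Y Z -> hom X Z
    where "f ;; g" := (comp f g);
  comp1f : forall X Y (f : hom X Y), idm X ;; f = f;
  compf1 : forall X Y (f : hom X Y), f ;; idm Y = f;
  compA : forall W X Y Z (f : hom W X) (g : hom X Y) (h : hom Y Z),
    f ;; (g ;; h) = (f ;; g) ;; h
}.
Arguments hom {c} X Y.
Arguments idm {c} X.
Arguments comp {c X Y Z} f g.
Arguments comp1f {c X Y} f.
Arguments compf1 {c X Y} f.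
Arguments compA {c W X Y Z} f g h.
Notation "f ;; g" := (comp f g) : cat_scope.

Record functor (C D : category) := Functor {
  fob :> C -> D;
  fmap : forall X Y : C, hom X Y -> hom (fob X) (fob Y);
  fmap1 : forall X : C, fmap (idm X) = idm (fob X);
  fmapM : forall (X Y Z : C) (f : hom X Y) (g : hom Y Z),
    fmap (f ;; g) = fmap f ;; fmap g
}.
Arguments fmap {C D} _ {X Y} _.

Section Arrows.
Variable C : category.

Definition is_iso (X Y : C) (f : hom X Y) : Prop :=
  exists g : hom Y X, f ;; g = idm X /\ g ;; f = idm Y.

Definition mono (X Y : C) (f : hom X Y) : Prop :=
  forall (T : C) (u v : hom T X), u ;; f = v ;; f -> u = v.

Definition is_coequalizer (X Y Q : C) (u v : hom X Y) (q : hom Y Q) : Prop :=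
  u ;; q = v ;; q /\
  forall (T : C) (t : hom Y T), u ;; t = v ;; t ->
    exists! h : hom Q T, q ;; h = t.

Definition regular_epi (Y Q : C) (q : hom Y Q) : Prop :=
  exists (X : C) (u v : hom X Y), is_coequalizer u v q.

Definition factors_through (X M Y : C) (f : hom X Y) (m : hom M Y) : Prop :=
  exists f' : hom X M, f' ;; m = f.

Definition jointly_strongly_epi (X X' Y : C) (f : hom X Y) (g : hom X' Y)
    : Prop :=
  forall (M : C) (m : hom M Y), mono m ->
    factors_through f m -> factors_through g m -> is_iso m.

Record zero_object := ZeroObject {
  zero : C;
  to_zero : forall X : C, hom X zero;
  to_zero_uniq : forall (X : C) (f : hom X zero), f = to_zero X;
  from_zero : forall X : C, hom zero X;
  from_zero_uniq : forall (X : C) (f : hom zero X), f = from_zero X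
}.

Record terminal_object := TerminalObject {
  terminal : C;
  to_terminal : forall X : C, hom X terminal;
  to_terminal_uniq : forall (X : C) (f : hom X terminal), f = to_terminal X
}.

Record pullback_of (X Y Z : C) (f : hom X Z) (g : hom Y Z) := PullbackOf {
  pb_ob : C;
  pb_fst : hom pb_ob X;
  pb_snd : hom pb_ob Y;
  pb_comm : pb_fst ;; f = pb_snd ;; g;
  pb_pair : forall (T : C) (u : hom T X) (v : hom T Y),
    u ;; f = v ;; g -> hom T pb_ob;
  pb_pair_fst : forall (T : C) (u : hom T X) (v : hom T Y)
    (e : u ;; f = v ;; g), pb_pair e ;; pb_fst = u;
  pb_pair_snd : forall (T : C) (u : hom T X) (v : hom T Y)
    (e : u ;; f = v ;; g), pb_pair e ;; pb_snd = v;
  pb_ext : forall (T : C) (h k : hom T pb_ob),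
    h ;; pb_fst = k ;; pb_fst -> h ;; pb_snd = k ;; pb_snd -> h = k
}.

(** A terminal object and pullbacks give all finite limits. They are chosen as
    part of the structure, so that the pullbacks and kernels below are objects
    of [C]; every property stated with them is invariant under another choice. *)
Record finite_limits := FiniteLimits {
  flim_terminal : terminal_object;
  flim_pullback : forall (X Y Z : C) (f : hom X Z) (g : hom Y Z),
    pullback_of f g
}.

Record is_regular (L : finite_limits) : Prop := IsRegular {
  kernel_pair_coequalizer : forall (X Y : C) (f : hom X Y),
    exists (Q : C) (q : hom X Q),
      is_coequalizer (pb_fst (flim_pullback L f f))
                     (pb_snd (flim_pullback L f f)) q;
  regular_epi_stable : forall (X Y Z : C) (f : hom X Z) (g : hom Y Z),
    regular_epi f -> regular_epi (pb_snd (flim_pullback L f g))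
}.

End Arrows.

Arguments zero {C} _.
Arguments to_zero {C} _ X.
Arguments from_zero {C} _ X.
Arguments flim_pullback {C} _ {X Y Z} f g.
Arguments pb_ob {C X Y Z f g} _.
Arguments pb_fst {C X Y Z f g} _.
Arguments pb_snd {C X Y Z f g} _.
Arguments pb_comm {C X Y Z f g} _.
Arguments pb_pair {C X Y Z f g} _ {T} u v e.
Arguments pb_pair_fst {C X Y Z f g} _ {T} u v e.
Arguments pb_pair_snd {C X Y Z f g} _ {T} u v e.
Arguments pb_ext {C X Y Z f g} _ {T} h k _ _.

Definition conservative (C D : category) (F : functor C D) : Prop :=
  forall (X Y : C) (f : hom X Y), is_iso (fmap F f) -> is_iso f.

Record pointed_regular_category := PointedRegularCategory {
  prc_cat :> category;
  prc_zero : zero_object prc_cat;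
  prc_lim : finite_limits prc_cat;
  prc_regular : is_regular prc_lim
}.

(** [Pt B] is the category of split epimorphisms over [B] with a specified
    section; [C] is protomodular when every change-of-base functor
    [Pt B -> Pt E] along [g : E -> B] reflects isomorphisms. *)

Section Points.
Variable C : category.

Record point (B : C) := Point {
  pt_ob : C;
  pt_proj : hom pt_ob B;
  pt_sect : hom B pt_ob;
  pt_split : pt_sect ;; pt_proj = idm B
}.
Arguments pt_ob {B} _.
Arguments pt_proj {B} _.
Arguments pt_sect {B} _.

Record point_hom (B : C) (x y : point B) := PointHom {
  pt_map : hom (pt_ob x) (pt_ob y);
  pt_map_proj : pt_map ;; pt_proj y = pt_proj x;
  pt_map_sect : pt_sect x ;; pt_map = pt_sect y
}.
Arguments pt_map {B x y} _.

Lemma point_hom_ext (B : C) (x y : point B) (h k : point_hom x y) :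
  pt_map h = pt_map k -> h = k.
Proof.
destruct h, k; simpl; intros ->; f_equal; apply proof_irrelevance.
Qed.

Definition point_id (B : C) (x : point B) : point_hom x x.
Proof.
exists (idm _); [apply comp1f | apply compf1].
Defined.

Definition point_comp (B : C) (x y z : point B)
    (h : point_hom x y) (k : point_hom y z) : point_hom x z.
Proof.
exists (pt_map h ;; pt_map k).
- rewrite <- compA, pt_map_proj; apply pt_map_proj.
- rewrite compA, pt_map_sect; apply pt_map_sect.
Defined.

Definition Pt (B : C) : category.
Proof.
refine (@Category (point B) (@point_hom B) (@point_id B) (@point_comp B) _ _ _);
  intros; apply point_hom_ext; simpl.
- apply comp1f.
- apply compf1.
- apply compA.
Defined.

Variables (L : finite_limits C) (E B : C) (g : hom E B).

Definition base_change_ob (x : point B) : point E.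
Proof.
refine (@Point E (pb_ob (flim_pullback L (pt_proj x) g))
  (pb_snd (flim_pullback L (pt_proj x) g))
  (pb_pair (flim_pullback L (pt_proj x) g) (g ;; pt_sect x) (idm E) _) _).
- apply pb_pair_snd.
Unshelve.
rewrite <- compA, pt_split, compf1, comp1f; reflexivity.
Defined.

Definition base_change_hom (x y : point B) (h : point_hom x y) :
  point_hom (base_change_ob x) (base_change_ob y).
Proof.
refine (@PointHom E (base_change_ob x) (base_change_ob y)
  (pb_pair (flim_pullback L (pt_proj y) g)
     (pb_fst (flim_pullback L (pt_proj x) g) ;; pt_map h)
     (pb_snd (flim_pullback L (pt_proj x) g)) _) _ _).
- apply pb_pair_snd.
- simpl; apply pb_ext.
  + rewrite <- compA, !pb_pair_fst, compA, pb_pair_fst, <- compA, pt_map_sect.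
    reflexivity.
  + rewrite <- compA, !pb_pair_snd; reflexivity.
Unshelve.
rewrite <- compA, pt_map_proj; apply pb_comm.
Defined.

Definition base_change : functor (Pt B) (Pt E).
Proof.
refine (@Functor (Pt B) (Pt E) base_change_ob base_change_hom _ _);
  intros; apply point_hom_ext; simpl; apply pb_ext.
- rewrite pb_pair_fst, comp1f, compf1; reflexivity.
- rewrite pb_pair_snd, comp1f; reflexivity.
- rewrite <- compA, !pb_pair_fst, compA, compA, pb_pair_fst; reflexivity.
- rewrite <- compA, !pb_pair_snd; reflexivity.
Defined.

End Points.

Definition protomodular (C : category) (L : finite_limits C) : Prop :=
  forall (E B : C) (g : hom E B), conservative (base_change L g).

Section ArrowCategory.
Variable C : category.

Record arrow := Arrow {
  dom : C;
  cod : C;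
  arr : hom dom cod
}.

Record arrow_hom (a b : arrow) := ArrowHom {
  top : hom (dom a) (dom b);
  bot : hom (cod a) (cod b);
  square : top ;; arr b = arr a ;; bot
}.
Arguments top {a b} _.
Arguments bot {a b} _.
Arguments square {a b} _.

Lemma arrow_hom_ext (a b : arrow) (f g : arrow_hom a b) :
  top f = top g -> bot f = bot g -> f = g.
Proof.
destruct f, g; simpl; intros -> ->; f_equal; apply proof_irrelevance.
Qed.

Definition arrow_id (a : arrow) : arrow_hom a a.
Proof.
exists (idm _) (idm _); rewrite comp1f, compf1; reflexivity.
Defined.

Definition arrow_comp (a b c : arrow)
    (f : arrow_hom a b) (g : arrow_hom b c) : arrow_hom a c.
Proof.
exists (top f ;; top g) (bot f ;; bot g).
rewrite <- compA, square, compA, square, compA; reflexivity.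
Defined.

Definition Arr : category.
Proof.
refine (@Category arrow arrow_hom arrow_id arrow_comp _ _ _);
  intros; apply arrow_hom_ext; simpl;
  solve [apply comp1f | apply compf1 | apply compA].
Defined.

(** A null-homotopy of [(f, f0) : a -> b] is a diagonal of the square. *)
Record null_homotopy (a b : Arr) (f : hom a b) := NullHomotopy {
  diag : hom (cod a) (dom b);
  diag_top : arr a ;; diag = top f;
  diag_bot : diag ;; arr b = bot f
}.

Definition fibration (a b : Arr) (f : hom a b) : Prop := regular_epi (top f).

Definition essentially_surjective (a b : Arr) (f : hom a b) : Prop :=
  jointly_strongly_epi (bot f) (arr b).

End ArrowCategory.

Arguments dom {C} _.
Arguments cod {C} _.
Arguments arr {C} _.
Arguments top {C a b} _.
Arguments bot {C a b} _.
Arguments square {C a b} _.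

Section StrongHKernel.
Variables (C : category) (L : finite_limits C).

Definition bot_pullback (a b : Arr C) (f : hom a b) :
  pullback_of (bot f) (arr b) := flim_pullback L (bot f) (arr b).

(** The comparison [∂(f, f0)_0 : A -> A0 ×_{f0, b} B]. *)
Definition partial0 (a b : Arr C) (f : hom a b) :
  hom (dom a) (pb_ob (bot_pullback f)) :=
  pb_pair (bot_pullback f) (arr a) (top f) (eq_sym (square f)).

Definition fully_faithful (a b : Arr C) (f : hom a b) : Prop :=
  is_iso (partial0 f).

Definition weak_equivalence (a b : Arr C) (f : hom a b) : Prop :=
  fully_faithful f /\ essentially_surjective f.

Definition hker (a b : Arr C) (f : hom a b) : Arr C := Arrow (partial0 f).

Definition hker_map (a b : Arr C) (f : hom a b) : hom (hker f) a.
Proof.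
refine (@ArrowHom C (hker f) a (idm (dom a)) (pb_fst (bot_pullback f)) _).
simpl; unfold partial0; rewrite comp1f, pb_pair_fst; reflexivity.
Defined.

Definition hker_null_homotopy (a b : Arr C) (f : hom a b) :
  null_homotopy (hker_map f ;; f).
Proof.
exists (pb_snd (bot_pullback f)); simpl.
- unfold partial0; rewrite pb_pair_snd, comp1f; reflexivity.
- symmetry; apply pb_comm.
Defined.

End StrongHKernel.

Section Kernel.
Variables (C : category) (Z : zero_object C) (L : finite_limits C).

Definition zero_map (X Y : C) : hom X Y := to_zero Z X ;; from_zero Z Y.

(** The kernel of [f : X -> Y] is the pullback of [f] along [0 -> Y]. *)
Definition ker_pullback (X Y : C) (f : hom X Y) :
  pullback_of f (from_zero Z Y) := flim_pullback L f (from_zero Z Y).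

Definition ker (X Y : C) (f : hom X Y) : C := pb_ob (ker_pullback f).

Definition ker_map (X Y : C) (f : hom X Y) : hom (ker f) X :=
  pb_fst (ker_pullback f).

Lemma ker_map_zero (X Y : C) (f : hom X Y) : ker_map f ;; f = zero_map (ker f) Y.
Proof.
refine (eq_trans (pb_comm (ker_pullback f)) _).
unfold zero_map; f_equal; apply to_zero_uniq.
Qed.

Lemma zero_map_comp (X Y T : C) (h : hom Y T) : zero_map X Y ;; h = zero_map X T.
Proof.
unfold zero_map; rewrite <- compA; f_equal; apply from_zero_uniq.
Qed.

Lemma comp_zero_map (X Y T : C) (h : hom T X) : h ;; zero_map X Y = zero_map T Y.
Proof.
unfold zero_map; rewrite compA; f_equal; apply to_zero_uniq.
Qed.

Variables (a b : Arr C) (f : hom a b).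

Lemma ker_induced_subproof :
  (ker_map (top f) ;; arr a) ;; bot f
  = to_zero Z (ker (top f)) ;; from_zero Z (cod b).
Proof.
rewrite <- compA, <- square, compA, ker_map_zero; apply zero_map_comp.
Qed.

Definition ker_induced : hom (ker (top f)) (ker (bot f)) :=
  pb_pair (ker_pullback (bot f)) (ker_map (top f) ;; arr a)
    (to_zero Z (ker (top f))) ker_induced_subproof.

Definition arr_ker : Arr C := Arrow ker_induced.

Definition arr_ker_map : hom arr_ker a.
Proof.
refine (@ArrowHom C arr_ker a (ker_map (top f)) (ker_map (bot f)) _).
symmetry; apply pb_pair_fst.
Defined.

Lemma comparison_bot_subproof :
  ker_map (bot f) ;; bot f = zero_map (ker (bot f)) (dom b) ;; arr b.
Proof.
rewrite zero_map_comp; apply ker_map_zero.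
Qed.

Definition comparison_bot : hom (ker (bot f)) (pb_ob (bot_pullback L f)) :=
  pb_pair (bot_pullback L f) (ker_map (bot f))
    (zero_map (ker (bot f)) (dom b)) comparison_bot_subproof.

Definition J : hom arr_ker (hker L f).
Proof.
refine (@ArrowHom C arr_ker (hker L f) (ker_map (top f)) comparison_bot _).
simpl; unfold partial0, comparison_bot; apply pb_ext.
- rewrite <- !compA, !pb_pair_fst; symmetry; apply pb_pair_fst.
- rewrite <- !compA, !pb_pair_snd, comp_zero_map; apply ker_map_zero.
Defined.

(** [J] is the canonical comparison: it is compatible with the maps to [a], and
    it sends the null-homotopy of the strong h-kernel to the zero one. *)
Lemma J_map : J ;; hker_map L f = arr_ker_map.
Proof.
apply arrow_hom_ext; simpl.
- apply compf1.
- apply pb_pair_fst.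
Qed.

Lemma J_null_homotopy :
  bot J ;; diag (hker_null_homotopy L f) = zero_map (cod arr_ker) (dom b).
Proof. apply pb_pair_snd. Qed.

End Kernel.

(* Main.v *)
Require Import Defs.

(** If the base change of a morphism of points along some [g : E -> B] is
    invertible, then the morphism is bijective on the kernels of the
    projections to [B], because every arrow killed by such a projection lifts
    to the pullback with zero component in [E]. Hence protomodularity means
    that a morphism of points which is bijective on kernels is invertible
    ([protomodular_iff_kernels]).

    The comparison [J] is always fully faithful, and its bottom component is a
    kernel of the projection [p : P -> B] from the pullback [P] of [f0] and
    [b]. That [J] is a weak equivalence therefore means: if a monomorphism into
    [P] contains the kernel of [p] and the arrow [d = partial0 f : A -> P],
    which satisfies [d ;; p = top f], then it is invertible
    ([J_weak_equivalence_iff]).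

    Suppose the category is protomodular, and let [m : M -> P] be such a
    monomorphism. Pulled back along the regular epimorphism [top f], both [M ->
    B] and [P -> B] acquire sections, induced by [d], and [m] becomes a
    morphism of points that is bijective on kernels, hence an isomorphism. So
    the regular epimorphism [A x_B P -> P] factors through [m], which is thus
    invertible ([protomodular_generation]).

    Conversely, a point [(q, t)] over [B] gives a fibration from [t] to [idm B]
    with components [idm B] and [q], for which [d] is essentially [t]. So the
    condition on [J] says that the kernel and the section of every point
    generate it ([point_generation]). This settles the case of a monic morphism
    of points. For an arbitrary one, bijective on kernels, the diagonal of its
    kernel pair contains the kernel and the section, so it is invertible and
    the morphism is monic. *)

Local Open Scope cat_scope.

(** * Monomorphisms and isomorphisms *)

Lemma is_iso_split_mono {C : category} {X Y : C} (m : hom X Y) (s : hom Y X) :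
  mono m -> s ;; m = idm Y -> is_iso m.
Proof.
intros Hm Hs; exists s; split; [|exact Hs].
apply Hm; rewrite <- compA, Hs, compf1, comp1f; reflexivity.
Qed.

Lemma is_iso_comp {C : category} {X Y T : C} (f : hom X Y) (g : hom Y T) :
  is_iso f -> is_iso g -> is_iso (f ;; g).
Proof.
intros [f' [Hf Hf']] [g' [Hg Hg']]; exists (g' ;; f'); split.
- rewrite <- compA, (compA g), Hg, comp1f; exact Hf.
- rewrite <- compA, (compA f'), Hf', comp1f; exact Hg'.
Qed.

Lemma is_iso_mono {C : category} {X Y : C} (f : hom X Y) : is_iso f -> mono f.
Proof.
intros [g [Hg _]] T u v E.
rewrite <- (compf1 u), <- (compf1 v), <- Hg, !compA, E; reflexivity.
Qed.

Lemma mono_of_comp {C : category} {X Y T : C} (f : hom X Y) (g : hom Y T) :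
  mono (f ;; g) -> mono f.
Proof.
intros H S u v E; apply H; rewrite !compA, E; reflexivity.
Qed.

Lemma regular_epi_id {C : category} (X : C) : regular_epi (idm X).
Proof.
exists X, (idm X), (idm X); split; [reflexivity|].
intros T t _; exists t; split; [apply comp1f|].
intros h <-; apply comp1f.
Qed.

Lemma regular_epi_extremal {C : category} {X M Y : C}
    (e : hom X Y) (m : hom M Y) :
  regular_epi e -> mono m -> factors_through e m -> is_iso m.
Proof.
intros (R & u & v & Huv & He) Hm (h & Hh).
(* As [m] is monic, [h] also coequalizes [u] and [v], so it descends to a
   section of [m]. *)
destruct (He _ h) as (s & Hs & _).
{ apply Hm; rewrite <- !compA, Hh; exact Huv. }
apply (is_iso_split_mono m s Hm).
destruct (He _ e Huv) as (k & _ & Uk).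
rewrite <- (Uk (s ;; m)), <- (Uk (idm Y)); [reflexivity| |].
- apply compf1.
- rewrite compA, Hs; exact Hh.
Qed.

(** * Points and kernels *)

(** The forgetful functor from points to the category is conservative. *)
Lemma point_is_iso {C : category} {B : C} {x y : Pt B} (h : hom x y) :
  is_iso (pt_map h) -> is_iso h.
Proof.
intros (k & Hk & Hk').
assert (Kp : k ;; pt_proj x = pt_proj y).
{ rewrite <- (pt_map_proj h), compA, Hk', comp1f; reflexivity. }
assert (Ks : pt_sect y ;; k = pt_sect x).
{ rewrite <- (pt_map_sect h), <- compA, Hk, compf1; reflexivity. }
exists (PointHom Kp Ks); split; apply point_hom_ext; assumption.
Qed.

Lemma is_iso_pt_map {C : category} {B : C} {x y : Pt B} (h : hom x y) :
  is_iso h -> is_iso (pt_map h).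
Proof.
intros (k & Hk & Hk'); exists (pt_map k); split.
- exact (f_equal (@pt_map _ _ _ _) Hk).
- exact (f_equal (@pt_map _ _ _ _) Hk').
Qed.

(** Invertibility of the restriction of [h] to the kernels of the projections,
    phrased with generalized elements so as not to choose kernels.  The lift
    [u] lies in the kernel because [h] commutes with the projections. *)
Definition iso_on_kernels {C : category} (Z : zero_object C) {B : C}
    {x y : point B} (h : point_hom x y) : Prop :=
  forall (T : C) (w : hom T (pt_ob y)), w ;; pt_proj y = zero_map Z T B ->
    exists! u : hom T (pt_ob x), u ;; pt_map h = w.

Definition contains_kernel {C : category} (Z : zero_object C) {M P B : C}
    (m : hom M P) (p : hom P B) : Prop :=
  forall (T : C) (w : hom T P), w ;; p = zero_map Z T B -> factors_through w m.

(** Over an arrow [w] killed by the projection, the pair [(w, 0)] is a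
    generalized element of the pullback, where [h] can be inverted. *)
Lemma base_change_iso_on_kernels {C : category} (Z : zero_object C)
    (L : finite_limits C) {E B : C} (g : hom E B) {x y : Pt B} (h : hom x y) :
  is_iso (fmap (base_change L g) h) -> iso_on_kernels Z h.
Proof.
intros Hiso T w Hw.
pose proof (is_iso_pt_map _ Hiso) as Hi.
pose proof (is_iso_mono _ Hi) as Hmono.
destruct Hi as (k & _ & Hk); simpl in k, Hk, Hmono.
assert (lift : forall (z : point B) (u : hom T (pt_ob z)),
          u ;; pt_proj z = zero_map Z T B -> u ;; pt_proj z = zero_map Z T E ;; g).
{ intros z u ->; symmetry; apply zero_map_comp. }
exists (pb_pair _ w (zero_map Z T E) (lift y w Hw) ;; k ;; pb_fst _); split.
- transitivity (pb_pair (flim_pullback L (pt_proj y) g) w (zero_map Z T E)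
                  (lift y w Hw) ;; pb_fst _); [|apply pb_pair_fst].
  rewrite <- (comp1f (pb_fst (flim_pullback L (pt_proj y) g))), <- Hk.
  rewrite <- !compA, pb_pair_fst; reflexivity.
- intros v Hv.
  assert (Hv0 : v ;; pt_proj x = zero_map Z T B).
  { rewrite <- (pt_map_proj h), compA, Hv; exact Hw. }
  rewrite <- (pb_pair_fst (flim_pullback L (pt_proj x) g) v
                (zero_map Z T E) (lift x v Hv0)).
  f_equal; apply Hmono.
  rewrite <- (compA _ k), Hk, compf1; apply pb_ext.
  + rewrite <- compA, !pb_pair_fst, compA, pb_pair_fst; symmetry; exact Hv.
  + rewrite <- compA, !pb_pair_snd; reflexivity.
Qed.

(** The reverse implication of [base_change_iso_on_kernels] for the base change
    along [0 -> B], which computes kernels. *)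
Lemma iso_on_kernels_base_change {C : category} (Z : zero_object C)
    (L : finite_limits C) {B : C} {x y : Pt B} (h : hom x y) :
  iso_on_kernels Z h -> is_iso (fmap (base_change L (from_zero Z B)) h).
Proof.
intros Hh; apply point_is_iso.
set (px := flim_pullback L (pt_proj x) (from_zero Z B)).
set (py := flim_pullback L (pt_proj y) (from_zero Z B)).
assert (into0 : forall (T : C) (u v : hom T (zero Z)), u = v).
{ intros T u v; rewrite (to_zero_uniq (z := Z) u); symmetry; apply to_zero_uniq. }
assert (ker0 : forall (T : C) (u : hom T (zero Z)),
          u ;; from_zero Z B = zero_map Z T B).
{ intros T u; unfold zero_map; f_equal; apply into0. }
destruct (Hh _ (pb_fst py)) as (s & Hs & _).
{ rewrite pb_comm; apply ker0. }
assert (Es : s ;; pt_proj x = pb_snd py ;; from_zero Z B).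
{ rewrite <- (pt_map_proj h), compA, Hs; apply pb_comm. }
apply (is_iso_split_mono _ (pb_pair px s (pb_snd py) Es)); simpl; fold px py.
- intros T u v E; apply pb_ext; [|apply into0].
  assert (Ef : u ;; pb_fst px ;; pt_map h = v ;; pb_fst px ;; pt_map h).
  { apply (f_equal (fun t => t ;; pb_fst py)) in E.
    rewrite <- !compA, pb_pair_fst, !compA in E; exact E. }
  destruct (Hh _ (v ;; pb_fst px ;; pt_map h)) as (r & _ & Ur).
  { rewrite <- compA, pt_map_proj, <- compA, pb_comm, compA; apply ker0. }
  rewrite <- (Ur _ Ef); apply Ur; reflexivity.
- apply pb_ext; [|apply into0].
  rewrite <- compA, pb_pair_fst, compA, pb_pair_fst, comp1f; exact Hs.
Qed.

(** In the pointed case, base change along the arrows [0 -> B] decides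
    protomodularity. *)
Lemma protomodular_iff_kernels {C : category} (Z : zero_object C)
    (L : finite_limits C) :
  protomodular L <->
  (forall (B : C) (x y : Pt B) (h : hom x y),
     iso_on_kernels Z h -> is_iso (pt_map h)).
Proof.
split.
- intros HL B x y h Hh.
  apply is_iso_pt_map, (HL _ _ (from_zero Z B)).
  apply iso_on_kernels_base_change; exact Hh.
- intros H E B g x y h Hh.
  apply point_is_iso, H, (base_change_iso_on_kernels Z L g); exact Hh.
Qed.

(** * The comparison with the strong h-kernel *)

(** An element of the pullback of [bot J] and [partial0 f] is one of [dom a]
    that [top f] kills: its component in [ker (bot f)] is determined. *)
Lemma J_fully_faithful {C : category} (Z : zero_object C) (L : finite_limits C)
    (a b : Arr C) (f : hom a b) : fully_faithful L (J Z L f).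
Proof.
unfold fully_faithful.
set (Q := bot_pullback L (J Z L f)).
assert (Hbot : mono (comparison_bot Z L f)).
{ intros T u v E; apply pb_ext.
  - apply (f_equal (fun t => t ;; pb_fst _)) in E.
    unfold comparison_bot in E; rewrite <- !compA, pb_pair_fst in E; exact E.
  - transitivity (to_zero Z T); [|symmetry]; apply to_zero_uniq. }
assert (E0 : pb_snd Q ;; top f = to_zero Z _ ;; from_zero Z (dom b)).
{ pose proof (f_equal (fun t => t ;; pb_snd _) (pb_comm Q)) as E; simpl in E.
  unfold comparison_bot, partial0 in E.
  rewrite <- !compA, !pb_pair_snd, comp_zero_map in E; symmetry; exact E. }
pose (s := pb_pair (ker_pullback Z L (top f)) (pb_snd Q) (to_zero Z _) E0).
assert (Es : s ;; ker_map Z L (top f) = pb_snd Q) by apply pb_pair_fst.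
apply (is_iso_split_mono _ s).
- apply (mono_of_comp _ (pb_snd Q)); unfold partial0; rewrite pb_pair_snd.
  intros T u v E; apply pb_ext; [exact E|].
  transitivity (to_zero Z T); [|symmetry]; apply to_zero_uniq.
- assert (Esnd : s ;; partial0 L (J Z L f) ;; pb_snd Q = pb_snd Q).
  { unfold partial0; rewrite <- compA, pb_pair_snd; exact Es. }
  apply pb_ext; rewrite comp1f; [|exact Esnd].
  apply Hbot.
  transitivity (pb_snd Q ;; arr (hker L f)); [|symmetry; exact (pb_comm Q)].
  rewrite <- compA, (pb_comm Q : _ ;; comparison_bot Z L f = _), compA.
  f_equal; exact Esnd.
Qed.

(** [bot J] is a kernel of the projection from the pullback to [dom b]. *)
Lemma comparison_bot_factors_iff {C : category} (Z : zero_object C)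
    (L : finite_limits C) {a b : Arr C} (f : hom a b) {M : C}
    (m : hom M (pb_ob (bot_pullback L f))) :
  factors_through (comparison_bot Z L f) m <->
  contains_kernel Z m (pb_snd (bot_pullback L f)).
Proof.
split.
- intros (k & Hk) T w Hw.
  assert (E : w ;; pb_fst _ ;; bot f = to_zero Z T ;; from_zero Z (cod b)).
  { rewrite <- compA, pb_comm, compA, Hw; apply zero_map_comp. }
  pose (t := pb_pair (ker_pullback Z L (bot f)) _ _ E
             : hom T (ker Z L (bot f))).
  exists (t ;; k); rewrite <- compA, Hk; unfold comparison_bot.
  apply pb_ext; rewrite <- compA, ?pb_pair_fst, ?pb_pair_snd.
  + apply pb_pair_fst.
  + rewrite comp_zero_map; symmetry; exact Hw.
- intros H; apply H; apply pb_pair_snd.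
Qed.

Lemma J_weak_equivalence_iff {C : category} (Z : zero_object C)
    (L : finite_limits C) {a b : Arr C} (f : hom a b) :
  weak_equivalence L (J Z L f) <->
  (forall (M : C) (m : hom M (pb_ob (bot_pullback L f))), mono m ->
     contains_kernel Z m (pb_snd (bot_pullback L f)) ->
     factors_through (partial0 L f) m -> is_iso m).
Proof.
split.
- intros [_ H] M m Hm Hk Hd; apply (H M m Hm); [|exact Hd].
  apply comparison_bot_factors_iff; exact Hk.
- intros H; split; [apply J_fully_faithful|].
  intros M m Hm Hk Hd; apply (H M m Hm); [|exact Hd].
  apply comparison_bot_factors_iff; exact Hk.
Qed.

(** * Protomodularity implies the condition on fibrations *)

(** The kernel of [p] and an arrow [d] whose composite with [p] is a regular
    epimorphism generate [P]: after pulling back along [d ;; p], the arrow [d]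
    becomes a section, and the claim becomes one about points. *)
Lemma protomodular_generation {C : category} (Z : zero_object C)
    (L : finite_limits C) {A P B M : C}
    (d : hom A P) (p : hom P B) (m : hom M P) :
  is_regular L -> protomodular L -> regular_epi (d ;; p) -> mono m ->
  contains_kernel Z m p -> factors_through d m -> is_iso m.
Proof.
intros HR HL Hdp Hm Hker (d' & Hd').
set (PP := flim_pullback L (d ;; p) p).
set (PM := flim_pullback L (d ;; p) (m ;; p)).
assert (EP : idm A ;; (d ;; p) = d ;; p) by apply comp1f.
assert (EM : idm A ;; (d ;; p) = d' ;; (m ;; p)).
{ rewrite comp1f, compA, Hd'; reflexivity. }
assert (Eh : pb_fst PM ;; (d ;; p) = (pb_snd PM ;; m) ;; p).
{ rewrite <- compA; apply pb_comm. }
pose (y := Point (pb_pair_fst PP (idm A) d EP) : Pt A).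
pose (x := Point (pb_pair_fst PM (idm A) d' EM) : Pt A).
pose (h0 := pb_pair PP (pb_fst PM) (pb_snd PM ;; m) Eh).
assert (Hh1 : h0 ;; pt_proj y = pt_proj x) by apply pb_pair_fst.
assert (Hh2 : pt_sect x ;; h0 = pt_sect y).
{ unfold h0; simpl; apply pb_ext; rewrite <- compA.
  - rewrite !pb_pair_fst; reflexivity.
  - rewrite !pb_pair_snd, compA, pb_pair_snd; exact Hd'. }
pose (h := @PointHom C A x y h0 Hh1 Hh2).
assert (Hiso : is_iso h0).
{ apply (proj1 (protomodular_iff_kernels Z L) HL A x y h).
  intros T w Hw; simpl in w, Hw |- *.
  destruct (Hker T (w ;; pb_snd PP)) as (k & Hk).
  { rewrite <- compA, <- pb_comm, compA, Hw; apply zero_map_comp. }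
  assert (Ew : w ;; pb_fst PP ;; (d ;; p) = k ;; (m ;; p)).
  { rewrite (compA k), Hk, <- !compA; f_equal; apply pb_comm. }
  exists (pb_pair PM (w ;; pb_fst PP) k Ew); split.
  - unfold h0; apply pb_ext; rewrite <- compA.
    + rewrite !pb_pair_fst; reflexivity.
    + rewrite pb_pair_snd, compA, pb_pair_snd; exact Hk.
  - intros v Hv; apply pb_ext.
    + rewrite pb_pair_fst, <- Hv, <- compA; unfold h0.
      rewrite pb_pair_fst; reflexivity.
    + rewrite pb_pair_snd; apply Hm; rewrite Hk, <- Hv, <- !compA; unfold h0.
      rewrite pb_pair_snd; reflexivity. }
apply (regular_epi_extremal (pb_snd PP) m).
- apply (regular_epi_stable HR); exact Hdp.
- exact Hm.
- destruct Hiso as (k & _ & Hk); exists (k ;; pb_snd PM).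
  rewrite <- (comp1f (pb_snd PP)), <- Hk, <- !compA; f_equal.
  unfold h0; symmetry; apply pb_pair_snd.
Qed.

(** * The condition on fibrations implies protomodularity *)

(** The condition on [J] for the fibration with components [idm B] and
    [pt_proj y], from the section of [y] to [idm B].  The pullback of [pt_proj y] along
    [idm B] is [pt_ob y] up to isomorphism. *)
Lemma point_generation {C : category} (Z : zero_object C)
    (L : finite_limits C) :
  (forall (a b : Arr C) (f : hom a b),
     fibration f -> weak_equivalence L (J Z L f)) ->
  forall (B : C) (y : point B) (M : C) (m : hom M (pt_ob y)), mono m ->
    contains_kernel Z m (pt_proj y) -> factors_through (pt_sect y) m ->
    is_iso m.
Proof.
intros H B y M m Hm Hker (s & Hs).
pose (a := Arrow (pt_sect y) : Arr C).
pose (b := Arrow (idm B) : Arr C).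
assert (Esq : idm B ;; arr b = arr a ;; pt_proj y).
{ simpl; rewrite comp1f, pt_split; reflexivity. }
pose (f := @ArrowHom C a b (idm B) (pt_proj y) Esq : hom a b).
pose proof (proj1 (J_weak_equivalence_iff Z L f) (H a b f (regular_epi_id B)))
  as HJ.
set (P := bot_pullback L f) in HJ.
assert (Esnd : pb_snd P = pb_fst P ;; pt_proj y).
{ rewrite <- (compf1 (pb_snd P)); symmetry; exact (pb_comm P). }
assert (ext : forall (T : C) (u v : hom T (pb_ob P)),
          u ;; pb_fst P = v ;; pb_fst P -> u = v).
{ intros T u v E; apply pb_ext; [exact E|].
  rewrite Esnd, !compA, E; reflexivity. }
assert (Em : m ;; bot f = m ;; pt_proj y ;; arr b).
{ symmetry; apply compf1. }
pose (m' := pb_pair P m (m ;; pt_proj y) Em).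
assert (Hm' : m' ;; pb_fst P = m) by apply pb_pair_fst.
rewrite <- Hm'; apply is_iso_comp.
- apply HJ.
  + apply (mono_of_comp _ (pb_fst P)); rewrite Hm'; exact Hm.
  + intros T w Hw.
    destruct (Hker T (w ;; pb_fst P)) as (k & Hk).
    { rewrite <- compA; rewrite Esnd in Hw; exact Hw. }
    exists k; apply ext; rewrite <- compA, Hm'; exact Hk.
  + exists s; apply ext; rewrite <- compA, Hm'.
    unfold partial0; rewrite pb_pair_fst; exact Hs.
- assert (Ei : idm (pt_ob y) ;; bot f = pt_proj y ;; arr b).
  { simpl; rewrite comp1f, compf1; reflexivity. }
  apply (is_iso_split_mono _ (pb_pair P _ _ Ei)); [|apply pb_pair_fst].
  exact ext.
Qed.

(** The kernel pair of [h], as a point over [B], has its kernel and its section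
    inside the diagonal; so [h] is monic. *)
Lemma iso_on_kernels_mono {C : category} (Z : zero_object C)
    (L : finite_limits C) {B : C} {x y : point B} (h : point_hom x y) :
  (forall (z : point B) (M : C) (m : hom M (pt_ob z)), mono m ->
     contains_kernel Z m (pt_proj z) -> factors_through (pt_sect z) m ->
     is_iso m) ->
  iso_on_kernels Z h -> mono (pt_map h).
Proof.
intros H Hh.
set (R := flim_pullback L (pt_map h) (pt_map h)).
pose (delta := pb_pair R (idm _) (idm _) eq_refl).
assert (D1 : delta ;; pb_fst R = idm _) by apply pb_pair_fst.
assert (D2 : delta ;; pb_snd R = idm _) by apply pb_pair_snd.
assert (Esec : pt_sect x ;; delta ;; (pb_fst R ;; pt_proj x) = idm B).
{ rewrite <- compA, (compA delta), D1, comp1f; apply pt_split. }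
assert (Hiso : is_iso delta).
{ apply (H (Point Esec) _ delta).
  - apply (mono_of_comp _ (pb_fst R)); rewrite D1.
    intros T u v; rewrite !compf1; exact (fun E => E).
  - intros T w Hw; simpl in w, Hw.
    exists (w ;; pb_fst R).
    assert (E : w ;; pb_fst R = w ;; pb_snd R).
    { destruct (Hh T (w ;; pb_fst R ;; pt_map h)) as (u & _ & Uu).
      - rewrite <- compA, pt_map_proj, <- compA; exact Hw.
      - rewrite <- (Uu (w ;; pb_fst R) eq_refl); apply Uu.
        rewrite <- !compA; f_equal; symmetry; apply pb_comm. }
    apply pb_ext; rewrite <- compA.
    + rewrite D1; apply compf1.
    + rewrite D2, compf1; exact E.
  - exists (pt_sect x); reflexivity. }
assert (E12 : pb_fst R = pb_snd R).
{ destruct Hiso as (k & _ & Hk).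
  rewrite <- (comp1f (pb_fst R)), <- (comp1f (pb_snd R)), <- Hk, <- !compA.
  rewrite D1, D2; reflexivity. }
intros T u v E.
rewrite <- (pb_pair_fst R u v E), E12; apply pb_pair_snd.
Qed.

Lemma protomodular_of_generation {C : category} (Z : zero_object C)
    (L : finite_limits C) :
  (forall (B : C) (y : point B) (M : C) (m : hom M (pt_ob y)), mono m ->
     contains_kernel Z m (pt_proj y) -> factors_through (pt_sect y) m ->
     is_iso m) ->
  protomodular L.
Proof.
intros H; apply (protomodular_iff_kernels Z); intros B x y h Hh.
apply (H B y).
- apply (iso_on_kernels_mono Z L h (H B) Hh).
- intros T w Hw; destruct (Hh T w Hw) as (u & Hu & _); exists u; exact Hu.
- exists (pt_sect x); apply pt_map_sect.
Qed.

(** * The equivalence *)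

Theorem proposition5p17 (A : pointed_regular_category) :
  protomodular (prc_lim A) <->
  (forall (a b : Arr A) (f : hom a b),
     fibration f ->
     weak_equivalence (prc_lim A) (J (prc_zero A) (prc_lim A) f)).
Proof.
split.
- intros HL a b f Hf; apply J_weak_equivalence_iff; intros M m Hm Hker Hd.
  apply (protomodular_generation (prc_zero A) (prc_lim A) (partial0 _ f)
           (pb_snd (bot_pullback (prc_lim A) f)) m); try assumption.
  + apply prc_regular.
  + unfold partial0; rewrite pb_pair_snd; exact Hf.
- intros H; apply (protomodular_of_generation (prc_zero A)).
  apply (point_generation _ (prc_lim A)); exact H.
Qed.
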